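(* Let $\alpha\in(0,1]$ and $\omega(t)=t^\alpha$. Let $(f,G):E\to\mathbb{R}\times X$ be a $1$-jet defined on a nonempty subset $E$ of a Hilbert space $(X,|\cdot|)$. There exists $F\in C^{1,\alpha}(X)$ with $(F,\nabla F)=(f,G)$ on $E$ if and only if $A(f,G)<\infty$. Moreover, in that case $F$ can be chosen so that $$A(F,\nabla F)\le 2^{1-\alpha}A(f,G).$$
   Context: Spaces are real. A $1$-jet on $E\subseteq X$ is a pair of functions $f:E\to\mathbb{R}$, $G:E\to X$ (the dual of $X$ is identified with $X$). $C^{1,\alpha}(X)$ is the set of Fréchet differentiable $g:X\to\mathbb{R}$ for which there is a constant $C>0$ with $|\nabla g(x)-\nabla g(y)|\le C|x-y|^\alpha$ for all $x,y\in X$. With $\varphi(t)=\int_0^t s^\alpha ds=\frac{t^{1+\alpha}}{1+\alpha}$, for a $1$-jet $(f,G)$ on $E$, $$A(f,G)=\sup_{x\in X;\ y,z\in E,\ |x-y|+|x-z|>0}\frac{|f(y)+\langle G(y),x-y\rangle-f(z)-\langle G(z),x-z\rangle|}{\varphi(|x-y|)+\varphi(|x-z|)}\in[0,\infty].$$ For differentiable $F:X\to\mathbb{R}$, $A(F,\nabla F)$ is this quantity for the jet $(F,\nabla F)$ on $E=X$. *)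

(* Defs.v *)
From HB Require Import structures.
From mathcomp Require Import all_boot all_order all_algebra.
From mathcomp Require Import all_classical all_reals all_analysis.

Set Implicit Arguments.
Unset Strict Implicit.
Unset Printing Implicit Defensive.

Import Order.TTheory GRing.Theory Num.Theory.
Import numFieldNormedType.Exports.

Local Open Scope classical_set_scope.
Local Open Scope ring_scope.

(* A real Hilbert space is a complete normed module [X] together with a
   symmetric positive definite bilinear form [ip : {dot X for idfun}] that
   induces its norm. *)
Definition induces_norm (R : realType) (X : completeNormedModType R)
    (ip : {dot X for idfun}) : Prop :=
  forall x : X, ip x x = `|x| ^+ 2.

(* [xget 0] only selects the Riesz representative of the differential, which is
   unique; the value 0 is a default for points where there is none. *)
Definition grad (R : realType) (X : completeNormedModType R)
    (ip : {dot X for idfun}) (F : X -> R) (x : X) : X :=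
  xget 0 [set v : X | differentiable F x /\ forall h : X, 'd F x h = ip v h].

Definition C1alpha (R : realType) (X : completeNormedModType R)
    (ip : {dot X for idfun}) (alpha : R) (F : X -> R) : Prop :=
  (forall x : X, differentiable F x) /\
  (exists C : R, 0 < C /\
     forall x y : X, `|grad ip F x - grad ip F y| <= C * `|x - y| `^ alpha).

(* The antiderivative of [fun s => s `^ alpha] vanishing at 0. *)
Definition phi (R : realType) (alpha t : R) : R :=
  t `^ (1 + alpha) / (1 + alpha).

Definition jet_quotient (R : realType) (X : completeNormedModType R)
    (ip : {dot X for idfun}) (alpha : R) (f : X -> R) (G : X -> X)
    (x y z : X) : R :=
  `|f y + ip (G y) (x - y) - f z - ip (G z) (x - z)|
  / (phi alpha `|x - y| + phi alpha `|x - z|).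

(* A 1-jet on [E] is given by functions on [X] of which only the values on [E]
   matter.  The supremum is taken in [0, +oo], hence the added 0: it makes the
   supremum of the empty family 0 (instead of -oo) when [X] is trivial and is
   irrelevant otherwise. *)
Definition jet_const (R : realType) (X : completeNormedModType R)
    (ip : {dot X for idfun}) (alpha : R) (E : set X) (f : X -> R) (G : X -> X)
    : \bar R :=
  ereal_sup (0%E |` [set r : \bar R | exists x y z : X,
    [/\ E y, E z, 0 < `|x - y| + `|x - z| &
        r = (jet_quotient ip alpha f G x y z)%:E]]).

Definition extends_jet (R : realType) (X : completeNormedModType R)
    (ip : {dot X for idfun}) (E : set X) (f : X -> R) (G : X -> X)
    (F : X -> R) : Prop :=
  forall x : X, E x -> F x = f x /\ grad ip F x = G x.

(* Main.v *)
Require Import Defs.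
From HB Require Import structures.
From mathcomp Require Import all_boot all_order all_algebra.
From mathcomp Require Import all_classical all_reals all_analysis.
From mathcomp Require Import ring lra.

Set Implicit Arguments.
Unset Strict Implicit.
Unset Printing Implicit Defensive.

Import Order.TTheory GRing.Theory Num.Theory.
Import numFieldNormedType.Exports.

Local Open Scope classical_set_scope.
Local Open Scope ring_scope.

(** Put [M = A(f, G)] and [K = 2 ^ (1 - alpha) * M].  Finiteness of [M] says
    exactly that every lower cone
    [x |-> f y + <G y, x - y> - M phi |x - y|] lies below every upper cone
    [x |-> f z + <G z, x - z> + M phi |x - z|], for [y] and [z] in [E].  A
    function squeezed between the two families has the prescribed value and
    gradient on [E], so the problem is to insert a regular function.

    Regularity is measured by an inequality without derivatives: [F] is
    K-paraconvex if it satisfies Jensen's inequality up to the error that a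
    remainder [K phi |h|] in the first order expansion would cause.  In a Hilbert
    space [phi |x|] has the first order expansion with remainder
    [2 ^ (1 - alpha) * phi |h|] ([phi_norm_taylor]), so the lower cones and the
    opposites of the upper cones are K-paraconvex ([paraconvex_cone]).  Let [F]
    be the supremum of all K-paraconvex functions below the upper cones.  It is
    K-paraconvex, and so is [- F] ([paraconvex_sandwich]): an average of
    translates of [F], lowered by the error that the upper cones allow, is again
    a competitor, hence lies below [F].  This is the mechanism by which the convex
    envelope of a C^(1,1) function inherits its second difference bound.

    When [F] and [- F] are both K-paraconvex, the difference quotients of [F]
    along a ray are Cauchy with an explicit rate; the limits form a bounded linear
    functional, and the Riesz theorem gives a vector [v] with
    [|F (x + h) - F x - <v, h>| <= K phi |h|] ([paraconvex_taylor]), with the same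
    [K].  This expansion carries the rest: it identifies [v] as the gradient
    ([taylor_grad]), makes the gradient Hoelder ([taylor_hoelder]) and, by the
    triangle inequality, gives [A(F, grad F) <= K] ([taylor_jet_const_le]).

    Conversely, the mean value theorem on segments provides such an expansion for
    every C^(1,alpha) function ([hoelder_taylor]), and the same triangle
    inequality bounds [A(f, G)]. *)

(** * Inner products and the Riesz theorem *)

Lemma exists_invS_lt (R : realType) (e : R) : 0 < e ->
  exists N : nat, forall n, (N <= n)%N -> n.+1%:R^-1 < e.
Proof.
move=> e0; exists (Num.truncn e^-1) => n Nn.
rewrite -ltf_pV2 ?(posrE, invr_gt0) // invrK.
by apply: lt_le_trans (truncnS_gt _) _; rewrite ler_nat ltnS.
Qed.

Section Hilbert.
Context {R : realType} {X : completeNormedModType R} (ip : {dot X for idfun}).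
Implicit Types (u v w x y h : X) (c : R).

Lemma ipC u v : ip u v = ip v u.
Proof. by rewrite (hermitian_subproof u v) expr0 mul1r. Qed.

Lemma ipDl u v w : ip (u + v) w = ip u w + ip v w.
Proof. exact: linearDl. Qed.

Lemma ipDr u v w : ip u (v + w) = ip u v + ip u w.
Proof. exact: linearDr. Qed.

Lemma ipZl c u v : ip (c *: u) v = c * ip u v.
Proof. by rewrite linearZl_LR. Qed.

Lemma ipZr c u v : ip u (c *: v) = c * ip u v.
Proof. by rewrite ipC ipZl ipC. Qed.

Lemma ipNl u v : ip (- u) v = - ip u v.
Proof. by rewrite -scaleN1r ipZl mulN1r. Qed.

Lemma ipNr u v : ip u (- v) = - ip u v.
Proof. by rewrite ipC ipNl ipC. Qed.

Lemma ip0r u : ip u 0 = 0.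
Proof. by rewrite -(scale0r (0 : X)) ipZr mul0r. Qed.

Hypothesis ip_norm : induces_norm ip.

Lemma sqr_normD u v : `|u + v| ^+ 2 = `|u| ^+ 2 + 2 * ip u v + `|v| ^+ 2.
Proof.
by rewrite -!ip_norm ipDl !ipDr (ipC v u); ring.
Qed.

Lemma ip_sep u v : (forall h, ip u h = ip v h) -> u = v.
Proof.
move=> uv; apply/eqP; rewrite -subr_eq0 -normr_eq0 -sqrf_eq0 -ip_norm.
by rewrite ipDl ipNl uv subrr.
Qed.

Lemma cauchy_schwarz u v : `|ip u v| <= `|u| * `|v|.
Proof.
have [->|u0] := eqVneq u 0.
  by rewrite ipC ip0r !normr0 mul0r.
rewrite -ler_sqr ?nnegrE ?mulr_ge0 // real_normK ?num_real // exprMn.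
have n0 : 0 < `|u| ^+ 2 by rewrite exprn_gt0 // normr_gt0.
have := sqr_ge0 `|(- (ip u v)) *: u + (`|u| ^+ 2) *: v|.
rewrite sqr_normD ipZl ipZr !normrZ normrN !exprMn real_normK ?num_real //.
rewrite normr_id => H.
rewrite -(ler_pM2l n0); nra.
Qed.

(** The Riesz representative of [L] is the minimiser of the strictly convex
    function [|x|^2 / 2 - L x]: the parallelogram law makes minimising sequences
    Cauchy, and the first variation vanishes at the limit. *)
Lemma riesz (L : X -> R) (C : R) :
  (forall u v, L (u + v) = L u + L v) -> (forall c u, L (c *: u) = c * L u) ->
  (forall u, `|L u| <= C * `|u|) -> exists v, forall h, L h = ip v h.
Proof.
move=> LD LZ LC.
pose J (x : X) : R := `|x| ^+ 2 / 2 - L x.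
have LN u : L (- u) = - L u by rewrite -scaleN1r LZ mulN1r.
have Lcont : continuous L.
  move=> x; apply/cvgrPdist_lt => e e0.
  have C1 : 0 < `|C| + 1 by rewrite ltr_pwDr.
  near=> y; rewrite -LN -LD.
  apply: le_lt_trans (LC _) _.
  apply: (@le_lt_trans _ _ ((`|C| + 1) * `|x - y|)).
    rewrite ler_wpM2r //; apply: le_trans (ler_norm _) _.
    by rewrite lerDl.
  rewrite mulrC -ltr_pdivlMr //; near: y.
  by apply: cvgr_dist_lt => //; rewrite divr_gt0.
have Jcont : continuous J.
  move=> x; apply: cvgB; last exact: Lcont.
  apply: cvgM; last exact: cvg_cst.
  by rewrite expr2; apply: cvgM; apply: cvg_norm; exact: cvg_id.
have Jlb x : - C ^+ 2 / 2 <= J x.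
  rewrite /J; have := LC x; have := ler_norm (L x); have := sqr_ge0 (`|x| - C).
  nra.
pose m := inf (range J).
have mJ x : m <= J x.
  by apply: ge_inf; [exists (- C ^+ 2 / 2) => _ [z _ <-] | exists x].
have parallelogram x y : `|x - y| ^+ 2 <= 4 * (J x + J y - 2 * m).
  have := mJ (2^-1 *: (x + y)).
  rewrite /J LZ LD normrZ exprMn ger0_norm // !sqr_normD ipNr normrN.
  lra.
have minseq (n : nat) : {x | J x < m + n.+1%:R^-1}.
  apply: cid.
  have n0 : 0 < n.+1%:R^-1 :> R by rewrite invr_gt0.
  have hJ : has_inf (range J).
    split; first by exists (J 0), 0.
    by exists (- C ^+ 2 / 2) => _ [z _ <-].
  by have [_ [x _ <-] Jx] := inf_adherent n0 hJ; exists x.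
pose a n := sval (minseq n).
have aP n : J (a n) < m + n.+1%:R^-1 := svalP (minseq n).
have cvga : cvg (a @ \oo).
  apply: cauchy_cvg; apply: cauchy_exP => e e0.
  have [|N Ne] := @exists_invS_lt R (e ^+ 2 / 8).
    by rewrite divr_gt0 // exprn_gt0.
  exists (a N); rewrite /fmapE -ball_normE /ball_; exists N => // n /= Nn.
  rewrite -ltr_sqr ?nnegrE ?(ltW e0) //.
  have := parallelogram (a N) (a n); have := aP N; have := aP n.
  have := Ne N (leqnn N); have := Ne n Nn.
  move: (N.+1%:R^-1) (n.+1%:R^-1) (J (a n)) (J (a N)) (`|_| ^+ 2) (e ^+ 2).
  by move=> ? ? ? ? ? ?; lra.
pose v := lim (a @ \oo).
have Jv : J v <= m.
  apply/ler_addgt0Pr => e e0.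
  have cJ : J (a n) @[n --> \oo] --> J v by apply: cvg_comp cvga (Jcont v).
  apply: (cvgr_to_le cJ).
  have [N Ne] := exists_invS_lt e0.
  exists N => // n /= Nn.
  by apply: le_trans (ltW (aP n)) _; rewrite lerD2l ltW // Ne.
exists v => h.
pose d := ip v h - L h.
have quad (t : R) : 0 <= t * d + t ^+ 2 * (`|h| ^+ 2 / 2).
  have := mJ (v + t *: h); move: Jv.
  rewrite /J /d sqr_normD LD LZ ipZr normrZ exprMn real_normK ?num_real //.
  lra.
apply/eqP; rewrite eq_sym -subr_eq0 -/d; apply/eqP.
(* The quadratic is nonnegative and vanishes at 0, so its slope d there is 0. *)
have := quad (- d / (`|h| ^+ 2 + 1)).
have h1 : 0 < `|h| ^+ 2 + 1 by rewrite ltr_wpDl ?sqr_ge0.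
set q := `|h| ^+ 2 in h1 *.
have -> : - d / (q + 1) * d + (- d / (q + 1)) ^+ 2 * (q / 2) =
  - (d ^+ 2 * ((q + 2) / (2 * (q + 1) ^+ 2))).
  by field; rewrite gt_eqF.
have q0 : 0 < (q + 2) / (2 * (q + 1) ^+ 2).
  by rewrite divr_gt0 ?mulr_gt0 ?exprn_gt0 //; lra.
rewrite oppr_ge0 pmulr_lle0 // => d0.
by apply/eqP; rewrite -sqrf_eq0 eq_le d0 sqr_ge0.
Unshelve. all: by end_near. Qed.
End Hilbert.

(** * First order expansion of powers of the norm *)

Section Powers.
Context {R : realType}.
Implicit Types (a c p q r s t x y : R).

(** Concavity of [x ^ t]: after the substitution [x = y exp u] the claim is the
    convexity of [exp], that is, its tangent inequality at the point [t u] used at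
    the points [u] and [0]. *)
Lemma powR_le_tangent t x y : 0 < t <= 1 -> 0 <= x -> 0 < y ->
  x `^ t <= y `^ t + t * y `^ (t - 1) * (x - y).
Proof.
move=> /andP[t0 t1] x0 y0.
have yt : y * y `^ (t - 1) = y `^ t by rewrite mulr_powRB1 // ltW.
have [->|xN0] := eqVneq x 0.
  rewrite powR0 ?gt_eqF //.
  have -> : y `^ t + t * y `^ (t - 1) * (0 - y) = y `^ t - t * (y * y `^ (t - 1)).
    by ring.
  by rewrite yt; have := powR_ge0 y t; nra.
have {xN0}x0 : 0 < x by rewrite lt_neqAle eq_sym xN0.
pose u := ln (x / y).
have xE : x = y * expR u.
  by rewrite /u lnK ?posrE ?divr_gt0 // mulrCA divff ?mulr1 // gt_eqF.
have -> : x `^ t = y `^ t * expR (t * u).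
  by rewrite xE powRM ?expR_ge0 ?(ltW y0) // (mulrC t) expRM.
have -> : t * y `^ (t - 1) * (x - y) = t * y `^ t * (expR u - 1).
  by rewrite -yt xE; ring.
rewrite -mulrA -[X in X + _]mulr1 (mulrCA t) -mulrDr ler_pM2l ?powR_gt0 //.
have e0 := expR_gt0 (t * u).
have e1 : expR (t * u) * (1 + (1 - t) * u) <= expR u.
  have -> : expR u = expR (t * u) * expR ((1 - t) * u).
    by rewrite -expRD; congr expR; ring.
  by rewrite ler_pM2l // expR_ge1Dx.
have e2 : expR (t * u) * (1 - t * u) <= 1.
  have E : expR (t * u) * expR (- (t * u)) = 1 by rewrite -expRD subrr expR0.
  rewrite -[leRHS]E.
  by rewrite ler_pM2l // expR_ge1Dx.
nra.
Qed.

Lemma powR_midpoint t x y : 0 < t <= 1 -> 0 <= x -> 0 <= y ->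
  x `^ t + y `^ t <= 2 `^ (1 - t) * (x + y) `^ t.
Proof.
move=> t01 x0 y0; have /andP[t0 t1] := t01.
have [xy0|xy0] := eqVneq (x + y) 0.
  have [-> ->] : x = 0 /\ y = 0 by split; lra.
  by rewrite addr0 powR0 ?gt_eqF // mulr0 addr0.
have z0 : 0 < (x + y) / 2 by rewrite divr_gt0 // lt_neqAle eq_sym xy0 addr_ge0.
have := powR_le_tangent t01 x0 z0; have := powR_le_tangent t01 y0 z0.
have -> : 2 `^ (1 - t) * (x + y) `^ t = 2 * ((x + y) / 2) `^ t.
  rewrite [in RHS]powRM ?addr_ge0 ?invr_ge0 // powRB ?pnatr_eq0 ?implybT //.
  rewrite powRr1 // (_ : 2^-1 `^ t = (2 `^ t)^-1); first by ring.
  by rewrite -powRN -mulN1r powRrM powR_inv1.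
by lra.
Qed.

Lemma powR_le_antitone t x y : t <= 0 -> 0 < x -> x <= y -> y `^ t <= x `^ t.
Proof.
move=> t0 x0 xy; have y0 := lt_le_trans x0 xy.
rewrite -(opprK t) !(powRN _ (- t)) lef_pV2 ?posrE ?powR_gt0 //.
by apply: ge0_ler_powR; rewrite ?oppr_ge0 // nnegrE ltW.
Qed.

Lemma sqr_powR x t : 0 <= x -> (x ^+ 2) `^ t = x `^ (2 * t).
Proof. by move=> x0; rewrite -powR_mulrn // -powRrM. Qed.

End Powers.

Section Exponent.
Context {R : realType}.
Variable alpha : R.
Hypothesis (alpha_gt0 : 0 < alpha) (alpha_le1 : alpha <= 1).
Implicit Types (a c p q r s t x y : R).

Lemma powR1D x : 0 <= x -> x `^ (1 + alpha) = x * x `^ alpha.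
Proof.
move=> x0; rewrite powRD ?powRr1 //.
by rewrite gt_eqF // addr_gt0.
Qed.

(** The one-dimensional case of [powR_norm_taylor], with increment [q + a]
    pointing from [a] through the origin to [- q].  The difference of the two
    sides is nondecreasing in [q], its derivative being nonnegative by
    [powR_midpoint], and it is nonnegative at [q = a]. *)
Lemma powR_colinear_taylor a q : 0 < a -> a <= q ->
  q `^ (1 + alpha) + (1 + alpha) * a `^ alpha * q + alpha * a `^ (1 + alpha)
  <= 2 `^ (1 - alpha) * (q + a) `^ (1 + alpha).
Proof.
move=> a0 aq.
pose psi : R -> R := fun x =>
  2 `^ (1 - alpha) * (x + a) `^ (1 + alpha) - x `^ (1 + alpha) -
  (1 + alpha) * a `^ alpha * x.
pose dpsi x := (1 + alpha) *
  (2 `^ (1 - alpha) * (x + a) `^ alpha - x `^ alpha - a `^ alpha).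
have dpsiP x : 0 < x -> is_derive x 1 psi (dpsi x).
  move=> x0.
  have xa0 : 0 < x + a by rewrite addr_gt0.
  have d1 := is_derive1_powR (1 + alpha) x0.
  have d2 := is_derive1_powR (1 + alpha) xa0.
  have d3 : is_derive x 1 ((@powR R ^~ (1 + alpha)) \o (shift a))
     ((1 + alpha) * (x + a) `^ (1 + alpha - 1) * 1).
    by apply: is_derive1_comp => //; exact: is_derive_shift.
  have d4 := is_deriveB (is_deriveB (is_deriveZ (2 `^ (1 - alpha)) d3) d1)
    (is_deriveZ ((1 + alpha) * a `^ alpha) (is_derive_id x 1)).
  have -> : psi = 2 `^ (1 - alpha) \*: ((@powR R ^~ (1 + alpha)) \o (shift a))
      - (@powR R ^~ (1 + alpha)) - ((1 + alpha) * a `^ alpha) \*: id.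
    by apply/funext => z.
  apply: (is_derive_eq d4).
  rewrite /dpsi (_ : 1 + alpha - 1 = alpha); last by ring.
  by rewrite -![_ *: _]/(_ * _); ring.
have psi_nd : psi a <= psi q.
  have [->//|aqN] := eqVneq a q.
  have {aqN}ltaq : a < q by rewrite lt_neqAle aqN.
  have [x||x xaq E] := @MVT R psi dpsi a q ltaq.
  - by rewrite in_itv /= => /andP[ax _]; apply: dpsiP; exact: lt_trans ax.
  - apply: derivable_within_continuous => x.
    rewrite in_itv /= => /andP[ax _]; apply: (@ex_derive _ _ _ _ _ _ (dpsi x)).
    by apply: dpsiP; exact: lt_le_trans ax.
  rewrite -subr_ge0 E mulr_ge0 ?subr_ge0 // /dpsi mulr_ge0 //.
    by rewrite addr_ge0 // ltW.
  have x0 : 0 <= x by move: xaq; rewrite in_itv /= => /andP[ax _]; lra.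
  have := @powR_midpoint R alpha x a; rewrite alpha_gt0 alpha_le1 x0 (ltW a0).
  by move=> /(_ isT isT isT); lra.
have psia : psi a = (2 - alpha) * a `^ (1 + alpha).
  rewrite /psi -mulr2n -[a *+ 2]mulr_natl powRM ?(ltW a0) //.
  rewrite mulrA -powRD ?pnatr_eq0 ?implybT //.
  rewrite (_ : 1 - alpha + (1 + alpha) = 2%:R); last by ring.
  by rewrite powR_mulrn // -mulrA (mulrC (a `^ alpha)) -powR1D ?(ltW a0) //; ring.
move: psi_nd; rewrite psia /psi.
have : 0 <= (1 - alpha) * a `^ (1 + alpha) by rewrite mulr_ge0 ?powR_ge0 ?subr_ge0.
lra.
Qed.

Local Notation phi := (phi alpha).

Lemma phi_ge0 x : 0 <= phi x.
Proof. by rewrite /phi divr_ge0 ?powR_ge0 // addr_ge0 // ltW. Qed.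

Lemma phi0 : phi 0 = 0.
Proof. by rewrite /phi powR0 ?mul0r // gt_eqF // addr_gt0. Qed.

Lemma phi_gt0 x : 0 < x -> 0 < phi x.
Proof. by move=> x0; rewrite /phi divr_gt0 ?powR_gt0 ?addr_gt0. Qed.

Lemma ler_phi x y : 0 <= x -> x <= y -> phi x <= phi y.
Proof.
move=> x0 xy; rewrite /phi ler_pM2r ?invr_gt0 ?addr_gt0 //.
by apply: ge0_ler_powR; rewrite ?nnegrE ?(le_trans x0 xy) // addr_ge0 // ltW.
Qed.

Lemma phiM c x : 0 <= c -> 0 <= x -> phi (c * x) = c * c `^ alpha * phi x.
Proof. by move=> c0 x0; rewrite /phi powRM // (powR1D c0); ring. Qed.

Lemma le0_powR_small (x c : R) : (forall s, 0 < s -> x <= c * s `^ alpha) -> x <= 0.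
Proof.
move=> xc; rewrite leNgt; apply/negP => x0.
have c0 : 0 < c by have := xc 1 ltr01; rewrite powR1 mulr1; exact: lt_le_trans.
have s0 : 0 < x / (2 * c) by rewrite divr_gt0 // mulr_gt0.
have := xc ((x / (2 * c)) `^ alpha^-1); rewrite powR_gt0 // => /(_ isT).
rewrite -powRrM mulVf ?gt_eqF // powRr1 ?(ltW s0) //.
have -> : c * (x / (2 * c)) = x / 2 by field; rewrite gt_eqF.
lra.
Qed.

(** The limit at 0 is taken as the supremum of the lower bounds
    [q s - c s ^ alpha], so that the rate survives with the same constant. *)
Lemma limit_with_rate (q : R -> R) (c : R) :
  (forall s t, 0 < s -> 0 < t -> `|q s - q t| <= c * (s `^ alpha + t `^ alpha)) ->
  exists l, forall s, 0 < s -> `|q s - l| <= c * s `^ alpha.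
Proof.
move=> qc.
pose A := [set q s - c * s `^ alpha | s in [set s | 0 < s]].
have ubA t : 0 < t -> ubound A (q t + c * t `^ alpha).
  move=> t0 _ [s /= s0 <-].
  by have := qc _ _ s0 t0; rewrite ler_norml => /andP[_]; lra.
have A1 : A !=set0 by exists (q 1 - c * 1 `^ alpha), 1 => //=.
exists (sup A) => s s0; rewrite ler_norml; apply/andP; split.
  by have := ge_sup A1 (ubA _ s0); lra.
suff : q s - c * s `^ alpha <= sup A by lra.
by apply: ub_le_sup; [exists (q 1 + c * 1 `^ alpha); exact: ubA | exists s].
Qed.

End Exponent.

Section NormTaylor.
Context {R : realType} {X : completeNormedModType R} (ip : {dot X for idfun}).
Hypothesis ip_norm : induces_norm ip.
Variable alpha : R.
Hypothesis (alpha_gt0 : 0 < alpha) (alpha_le1 : alpha <= 1).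
Local Notation phi := (phi alpha).

(** With [a = |p|], [r = |h|] and [c = <p, h>], the left-hand side is
    [(a^2 + 2c + r^2) ^ ((1 + alpha) / 2)], a concave function of [c], whereas the
    right-hand side is affine in [c].  So it is enough to bound a tangent: the one
    of matching slope, at [c = - r^2 / 2], when this value is attained
    ([r <= 2a]), and the one at the endpoint [c = - a r] otherwise, which is the
    collinear case. *)
Lemma powR_norm_taylor (p h : X) :
  `|p + h| `^ (1 + alpha) <= `|p| `^ (1 + alpha)
    + (1 + alpha) * `|p| `^ (alpha - 1) * ip p h
    + 2 `^ (1 - alpha) * `|h| `^ (1 + alpha).
Proof.
have b0 : 0 < 1 + alpha by rewrite addr_gt0.
have two1 : 1 <= 2 `^ (1 - alpha) :> R.
  by rewrite -[leLHS](powRr0 2) ler_powR ?subr_ge0 // ler1n.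
have [->|pN0] := eqVneq p 0.
  rewrite add0r normr0 powR0 ?gt_eqF // ipC ip0r mulr0 !add0r.
  by rewrite ler_peMl ?powR_ge0.
have [->|hN0] := eqVneq h 0.
  by rewrite addr0 ip0r mulr0 normr0 [0 `^ (1 + _)]powR0 ?gt_eqF // mulr0 !addr0.
have a0 : 0 < `|p| by rewrite normr_gt0.
have r0 : 0 < `|h| by rewrite normr_gt0.
have N0 : 0 <= `|p + h| by [].
have := sqr_normD ip_norm p h; have := cauchy_schwarz ip_norm p h.
rewrite ler_norml => /andP[cl _].
move: cl; move: (`|p|) (`|h|) (ip p h) (`|p + h|) a0 r0 N0.
move=> a r c N a0 r0 N0 cl NE {pN0 hN0}.
pose t : R := (1 + alpha) / 2.
have t01 : 0 < t <= 1 by move: alpha_gt0 alpha_le1; rewrite /t; lra.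
have tE x : 0 <= x -> (x ^+ 2) `^ t = x `^ (1 + alpha).
  by move=> x0; rewrite sqr_powR //; congr (_ `^ _); rewrite /t; field.
have tE1 x : 0 <= x -> (x ^+ 2) `^ (t - 1) = x `^ (alpha - 1).
  by move=> x0; rewrite sqr_powR //; congr (_ `^ _); rewrite /t; field.
have [ra|ar] := leP r (2 * a).
  have a20 : 0 < a ^+ 2 by rewrite exprn_gt0.
  have := powR_le_tangent t01 (sqr_ge0 N) a20.
  rewrite !tE ?tE1 ?(ltW a0) // NE => /le_trans; apply.
  have -> : a ^+ 2 + 2 * c + r ^+ 2 - a ^+ 2 = 2 * c + r ^+ 2 by ring.
  have -> : t * a `^ (alpha - 1) * (2 * c + r ^+ 2) =
      (1 + alpha) * a `^ (alpha - 1) * c + t * a `^ (alpha - 1) * r ^+ 2.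
    by rewrite /t; field.
  rewrite addrA lerD2l.
  (* The square [r^2] costs the factor [2 ^ (1 - alpha)] because [r / 2 <= a]. *)
  have ar1 : a `^ (alpha - 1) <= 2 `^ (1 - alpha) * r `^ (alpha - 1).
    have r20 : 0 < r / 2 by rewrite divr_gt0.
    have -> : 2 `^ (1 - alpha) * r `^ (alpha - 1) = (r / 2) `^ (alpha - 1).
      rewrite powRM ?(ltW r0) ?invr_ge0 // mulrC; congr (_ * _).
      by rewrite -powR_inv1 // -powRrM; congr (_ `^ _); ring.
    by apply: powR_le_antitone; rewrite ?subr_le0 //; lra.
  have -> : r `^ (1 + alpha) = r ^+ 2 * r `^ (alpha - 1).
    by rewrite expr2 -mulrA mulr_powRB1 ?(ltW r0) // powR1D ?(ltW r0).
  rewrite [leRHS]mulrCA [leLHS]mulrC ler_wpM2l ?sqr_ge0 //.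
  by apply: le_trans ar1; rewrite ler_piMl ?powR_ge0 //; case/andP: t01.
(* Now [2a < r], and the tangent is taken at [(r - a)^2], where [p] and [h] are
   opposite. *)
have aq : a <= r - a by lra.
have q20 : 0 < (r - a) ^+ 2 by rewrite exprn_gt0 //; lra.
have := powR_le_tangent t01 (sqr_ge0 N) q20.
rewrite !tE ?tE1 // ?NE; try lra.
move/le_trans; apply.
have := powR_colinear_taylor alpha_gt0 alpha_le1 a0 aq.
rewrite subrK.
have E1 : a * a `^ (alpha - 1) = a `^ alpha by rewrite mulr_powRB1 // ltW.
rewrite !(powR1D alpha_gt0 (ltW a0)) -E1.
have mono : (r - a) `^ (alpha - 1) <= a `^ (alpha - 1).
  by apply: powR_le_antitone => //; rewrite subr_le0.
have : (c + a * r) * (r - a) `^ (alpha - 1) <= (c + a * r) * a `^ (alpha - 1).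
  by rewrite ler_wpM2l //; lra.
have -> : a ^+ 2 + 2 * c + r ^+ 2 - (r - a) ^+ 2 = 2 * (c + a * r) by ring.
move: (2 `^ _) (r `^ (1 + alpha)) ((r - a) `^ (1 + alpha)) => A B C.
move: ((r - a) `^ (alpha - 1)) (a `^ (alpha - 1)) => D F.
have -> : t * D * (2 * (c + a * r)) = (1 + alpha) * ((c + a * r) * D).
  by rewrite /t; field.
move=> H1 H2.
have := ler_wpM2l (ltW b0) H1; lra.
Qed.

Lemma phi_norm_taylor (p : X) : exists v, forall h,
  phi `|p + h| <= phi `|p| + ip v h + 2 `^ (1 - alpha) * phi `|h|.
Proof.
exists (`|p| `^ (alpha - 1) *: p) => h; rewrite ipZl /phi.
have b0 : 0 < 1 + alpha by rewrite addr_gt0.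
rewrite ler_pdivrMr //; apply: le_trans (powR_norm_taylor p h) _.
by rewrite le_eqVlt; apply/orP; left; apply/eqP; field; rewrite gt_eqF.
Qed.
End NormTaylor.

(** * Paraconvexity and gradients *)

(** Jensen's inequality at [p], a convex combination of [p + t *: h] and
    [p - s *: h].  The error term is the one caused at these two points by a
    remainder [K * phi |.|] in an affine minorant at [p], see
    [paraconvex_subgradient]. *)
Definition paraconvex (R : realType) (X : normedModType R) (alpha K : R)
    (F : X -> R) : Prop :=
  forall (p h : X) (s t : R), 0 <= s -> 0 <= t -> s + t = 1 ->
    F p <= s * F (p + t *: h) + t * F (p - s *: h)
      + K * (s * phi alpha `|t *: h| + t * phi alpha `|s *: h|).

Section Gradient.
Context {R : realType} {X : completeNormedModType R} (ip : {dot X for idfun}).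
Hypothesis ip_norm : induces_norm ip.
Variable alpha : R.
Hypothesis (alpha_gt0 : 0 < alpha).
Local Notation phi := (phi alpha).
Implicit Types (F : X -> R) (v x h : X) (K : R).

Lemma grad_eq F x v :
  differentiable F x -> (forall h, 'd F x h = ip v h) -> grad ip F x = v.
Proof.
move=> dF dv; rewrite /grad; case: xgetP => [w _ [_ dw]|/(_ v) []] //.
by apply: (ip_sep ip_norm) => h; rewrite -dw -dv.
Qed.

(** The Riesz theorem guarantees that the set from which [grad] chooses is
    nonempty. *)
Lemma diff_grad F x h : differentiable F x -> 'd F x h = ip (grad ip F x) h.
Proof.
move=> dF.
have /linear_boundedP [C [_ CP]] : bounded_near ('d F x) (nbhs 0).
  by apply: continuous_linear_bounded; exact: diff_continuous.
have dD u v : 'd F x (u + v) = 'd F x u + 'd F x v by rewrite linearD.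
have dZ c u : 'd F x (c *: u) = c * 'd F x u by rewrite linearZ.
have dC u : `|'d F x u| <= (C + 1) * `|u| by apply: CP; rewrite ltrDl.
by have [v dv] := riesz ip_norm dD dZ dC; rewrite dv (grad_eq dF dv).
Qed.

Lemma taylor_grad F x v K :
  (forall h, `|F (x + h) - F x - ip v h| <= K * phi `|h|) ->
  differentiable F x /\ grad ip F x = v.
Proof.
move=> FK.
have lin_ip : linear (ip v : X -> R^o).
  by move=> c u w; rewrite ipDr ipZr.
pose L : {linear X -> R^o} := HB.pack (ip v : X -> R^o)
  (GRing.isLinear.Build R X R^o *:%R (ip v) lin_ip).
have Lcont : continuous L.
  apply: bounded_linear_continuous; apply/linear_boundedP.
  exists `|v|; split => // C vC h; apply: le_trans (cauchy_schwarz ip_norm v h) _.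
  by rewrite ler_wpM2r // ltW.
have Lo : F \o shift x = cst (F x) + L +o_ 0 id.
  apply/eqaddoP => e e0; near=> h.
  have -> : (F \o shift x - (cst (F x) + L)) h = F (x + h) - F x - ip v h.
    by rewrite /= !fctE /= opprD addrA (addrC h).
  apply: le_trans (FK h) _.
  have K1 : 0 < `|K| + 1 by rewrite ltr_pwDr.
  have ha : `|h| `^ alpha <= e / (`|K| + 1).
    have -> : e / (`|K| + 1) = ((e / (`|K| + 1)) `^ alpha^-1) `^ alpha.
      by rewrite -powRrM mulVf ?gt_eqF // powRr1 // divr_ge0 // ltW.
    apply: ge0_ler_powR; rewrite ?nnegrE ?powR_ge0 ?(ltW alpha_gt0) //.
    by near: h; apply: nbhs0_le; rewrite powR_gt0 // divr_gt0.
  apply: (@le_trans _ _ ((`|K| + 1) * (`|h| * `|h| `^ alpha))).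
    apply: le_trans (ler_wpM2r _ (ler_norm _)) _; first exact: phi_ge0.
    apply: ler_pM; rewrite ?phi_ge0 ?lerDl //.
    rewrite /phi powR1D // ler_pdivrMr ?addr_gt0 //.
    by rewrite ler_peMr ?mulr_ge0 ?powR_ge0 // lerDl ltW.
  rewrite mulrCA mulrC ler_wpM2r // mulrC -ler_pdivlMr //.
have dL := diff_unique Lcont Lo.
have dF : differentiable F x by apply/diff_locallyP; rewrite dL.
by split => //; apply: grad_eq => // h; rewrite dL.
Unshelve. all: by end_near. Qed.

End Gradient.

(** * Sandwiched functions and cones *)

Section Paraconvex.
Context {R : realType} {X : completeNormedModType R}.
Variables (alpha K : R).
Local Notation phi := (phi alpha).
Local Notation paraconvex := (paraconvex alpha K).
Implicit Types (F u : X -> R).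

Lemma paraconvex_sup (H : set (X -> R)) : H !=set0 ->
  (forall h, H h -> paraconvex h) ->
  (forall x, has_ubound [set h x | h in H]) ->
  paraconvex (fun x => sup [set h x | h in H]).
Proof.
move=> [h0 Hh0] Hp Hub p k s t s0 t0 st; apply: ge_sup; first by exists (h0 p), h0.
move=> _ [h Hh <-]; apply: le_trans (Hp h Hh p k s t s0 t0 st) _.
by rewrite lerD2r lerD // ler_wpM2l //; apply: ub_le_sup => //; exists h.
Qed.

(** Paraconvexity of [- F] is the heart of the construction.  Given weights
    [s + t = 1] and a direction [k], the function
    [x |-> s F (x + t k) + t F (x - s k) - D], where [D] is the error in the
    inequality to be proved, is paraconvex, because paraconvexity is invariant
    under translations and convex combinations, and it lies below each [u] in [U],
    because [- u] is paraconvex.  So it lies below the supremum [F], which is the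
    claim. *)
Lemma paraconvex_sandwich (U : set (X -> R)) h0 : U !=set0 ->
  (forall u, U u -> paraconvex (fun x => - u x)) ->
  paraconvex h0 -> (forall u x, U u -> h0 x <= u x) ->
  exists F, [/\ paraconvex F, paraconvex (fun x => - F x),
    (forall h, paraconvex h -> (forall u x, U u -> h x <= u x) ->
       forall x, h x <= F x) &
    (forall u x, U u -> F x <= u x)].
Proof.
move=> [u0 Uu0] Uc h0c h0U.
pose H := [set h | paraconvex h /\ forall u x, U u -> h x <= u x].
have H0 : H h0 by [].
have Hub u x : U u -> ubound [set h x | h in H] (u x).
  by move=> Uu _ [h [_ hU] <-]; exact: hU.
have hub x : has_ubound [set h x | h in H] by exists (u0 x); exact: Hub.
pose F x := sup [set h x | h in H].
have HF h x : H h -> h x <= F x by move=> Hh; apply: ub_le_sup => //; exists h.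
have FU u x : U u -> F x <= u x.
  by move=> Uu; apply: ge_sup; [exists (h0 x), h0 | exact: Hub].
have Fc : paraconvex F by apply: paraconvex_sup => //; [exists h0 | move=> h []].
exists F; split => // [p k s t s0 t0 st|h hc hU x]; last exact: HF.
pose D := K * (s * phi `|t *: k| + t * phi `|s *: k|).
pose h x := s * F (x + t *: k) + t * F (x - s *: k) - D.
suff : H h by move=> /(HF h p); rewrite /h /D; lra.
split=> [q j a b a0 b0 ab|u x Uu].
  have F1 := ler_wpM2l s0 (Fc (q + t *: k) j a b a0 b0 ab).
  have F2 := ler_wpM2l t0 (Fc (q - s *: k) j a b a0 b0 ab).
  have E : D = a * D + b * D by rewrite -mulrDl ab mul1r.
  have ED : K * (a * phi `|b *: j| + b * phi `|a *: j|) =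
    s * (K * (a * phi `|b *: j| + b * phi `|a *: j|)) +
    t * (K * (a * phi `|b *: j| + b * phi `|a *: j|)).
    by rewrite -mulrDl st mul1r.
  rewrite /h (addrAC q) (addrAC q (b *: j)) (addrAC q _ (t *: k)).
  rewrite (addrAC q (- (a *: j)) (- _)) {1}E ED.
  move: F1 F2; lra.
have u1 := ler_wpM2l s0 (FU u (x + t *: k) Uu).
have u2 := ler_wpM2l t0 (FU u (x - s *: k) Uu).
by have := Uc u Uu x k s t s0 t0 st; rewrite /h /D; lra.
Qed.

End Paraconvex.

Section Cones.
Context {R : realType} {X : completeNormedModType R} (ip : {dot X for idfun}).
Hypothesis ip_norm : induces_norm ip.
Variable alpha : R.
Hypothesis (alpha_gt0 : 0 < alpha) (alpha_le1 : alpha <= 1).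
Local Notation phi := (phi alpha).
Implicit Types (F : X -> R) (K : R).

Lemma paraconvex_subgradient K F :
  (forall p, exists v, forall h, F p + ip v h - K * phi `|h| <= F (p + h)) ->
  paraconvex alpha K F.
Proof.
move=> sub p h s t s0 t0 st; have [v vP] := sub p.
have := ler_wpM2l s0 (vP (t *: h)); have := ler_wpM2l t0 (vP (- (s *: h))).
rewrite ipNr !ipZr normrN.
have E : F p = s * F p + t * F p by rewrite -mulrDl st mul1r.
rewrite {3}E; lra.
Qed.

Lemma paraconvex_cone (M c : R) (w y : X) : 0 <= M ->
  paraconvex alpha (2 `^ (1 - alpha) * M)
    (fun x => c + ip w (x - y) - M * phi `|x - y|).
Proof.
move=> M0; apply: paraconvex_subgradient => p.
have [v vP] := phi_norm_taylor ip_norm alpha_gt0 alpha_le1 (p - y).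
exists (w - M *: v) => h.
have := ler_wpM2l M0 (vP h).
rewrite (addrAC p h) ipDr ipDl ipNl ipZl; lra.
Qed.

(** Cones are bounded on unit balls, a property that the sandwiched function
    inherits and that makes its directional derivatives bounded. *)
Lemma cone_bounded (M c : R) (w y x : X) : 0 <= M ->
  exists B, forall h, `|h| <= 1 ->
    `|c + ip w (x + h - y) - M * phi `|x + h - y| | <= B.
Proof.
move=> M0.
exists (`|c| + `|w| * (`|x - y| + 1) + M * phi (`|x - y| + 1)) => h h1.
have xh : `|x + h - y| <= `|x - y| + 1.
  by rewrite addrAC (le_trans (ler_normD _ _)) // lerD2l.
apply: le_trans (ler_normB _ _) _; apply: lerD.
  apply: le_trans (ler_normD _ _) _; rewrite lerD2l.
  apply: le_trans (cauchy_schwarz ip_norm _ _) _.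
  by rewrite ler_wpM2l.
rewrite ger0_norm; last by apply: mulr_ge0 => //; exact: phi_ge0.
by rewrite ler_wpM2l ?ler_phi.
Qed.

(** For [a <= b] the point [x + a h] is the convex combination of [x + b h] and
    [x] with weights [a / b] and [1 - a / b]; dividing both paraconvexity
    inequalities by [a] compares the two slopes. *)
Lemma paraconvex_slopes K F x h : 0 <= K ->
  paraconvex alpha K F -> paraconvex alpha K (fun x => - F x) ->
  forall a b, 0 < a -> 0 < b ->
  `|(F (x + a *: h) - F x) / a - (F (x + b *: h) - F x) / b|
    <= K * phi `|h| * (a `^ alpha + b `^ alpha).
Proof.
move=> K0 cF cNF.
wlog suff main : / forall a b, 0 < a -> a <= b ->
  `|(F (x + a *: h) - F x) / a - (F (x + b *: h) - F x) / b|
    <= K * phi `|h| * (a `^ alpha + b `^ alpha).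
  move=> a b a0 b0; have [ab|/ltW ba] := leP a b; first exact: main.
  by rewrite distrC (addrC (a `^ alpha)); exact: main.
move=> a b a0 ab; have b0 := lt_le_trans a0 ab.
pose s := a / b; pose t := 1 - s.
have s0 : 0 <= s by rewrite divr_ge0 ?ltW.
have t0 : 0 <= t by rewrite subr_ge0 ler_pdivrMr ?mul1r.
have st : s + t = 1 by rewrite /t addrC subrK.
have sb : s * b = a by rewrite /s divfK // gt_eqF.
have := cF (x + a *: h) (b *: h) s t s0 t0 st.
have := cNF (x + a *: h) (b *: h) s t s0 t0 st.
rewrite !scalerA sb -!addrA subrr addr0 -scalerDl.
have -> : a + t * b = b by rewrite /t mulrBl sb mul1r addrC subrK.
have -> : t * b = b - a by rewrite /t mulrBl sb mul1r.
move=> H1 H2.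
set d := K * _ in H1 H2.
have dle : d <= a * (K * phi `|h| * (a `^ alpha + b `^ alpha)).
  have ba0 : 0 <= b - a by rewrite subr_ge0.
  rewrite /d !normrZ (ger0_norm ba0) (gtr0_norm a0) !phiM ?(ltW a0) //.
  have -> : a * (K * phi `|h| * (a `^ alpha + b `^ alpha)) =
    K * (s * (b * b `^ alpha * phi `|h|) + a * a `^ alpha * phi `|h|).
    by ring: sb.
  rewrite ler_wpM2l // lerD //.
    rewrite ler_wpM2l // ler_wpM2r ?phi_ge0 // ler_pM ?powR_ge0 // ?gerBl ?(ltW a0) //.
    by apply: ge0_ler_powR; rewrite ?nnegrE ?gerBl ?(ltW a0) ?(ltW b0) ?(ltW alpha_gt0).
  apply: ler_piMl; last by rewrite /t gerBl.
  by apply: mulr_ge0; rewrite ?phi_ge0 // mulr_ge0 ?powR_ge0 // ltW.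
have aE : (F (x + a *: h) - F x) / a - (F (x + b *: h) - F x) / b =
   a^-1 * (F (x + a *: h) - s * F (x + b *: h) - t * F x).
  by rewrite /t /s; field; rewrite !gt_eqF.
rewrite aE normrM gtr0_norm ?invr_gt0 // ler_pdivrMl //.
apply: le_trans dle; rewrite ler_norml; lra.
Qed.

End Cones.

(** * First order expansions with a Hoelder remainder *)

Section Taylor.
Context {R : realType} {X : completeNormedModType R} (ip : {dot X for idfun}).
Hypothesis ip_norm : induces_norm ip.
Variable alpha : R.
Hypothesis (alpha_gt0 : 0 < alpha) (alpha_le1 : alpha <= 1).
Local Notation phi := (phi alpha).
Implicit Types (F : X -> R) (K : R).

Lemma eq_powR_small (u w c : R) :
  (forall s, 0 < s -> `|u - w| <= c * s `^ alpha) -> u = w.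
Proof.
move=> /(le0_powR_small alpha_gt0); rewrite normr_le0 subr_eq0.
by move/eqP.
Qed.

(** The directional derivatives [L h] exist by [paraconvex_slopes], with an error
    of order [s ^ alpha] at scale [s].  Every identity between them is obtained by
    bounding its defect by a multiple of [s ^ alpha] for all [s]; additivity comes
    from the paraconvexity inequalities at the midpoint of [x + 2s u] and
    [x + 2s w].  The rate at [s = 1] is the expansion. *)
Lemma paraconvex_taylor K F x : 0 <= K ->
  paraconvex alpha K F -> paraconvex alpha K (fun x => - F x) ->
  (exists B, forall h, `|h| <= 1 -> `|F (x + h)| <= B) ->
  exists v, forall h, `|F (x + h) - F x - ip v h| <= K * phi `|h|.
Proof.
move=> K0 cF cNF [B FB].
pose q h s : R := (F (x + s *: h) - F x) / s.
have /choice[L LP] : forall h, exists l, forall s, 0 < s ->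
    `|q h s - l| <= K * phi `|h| * s `^ alpha.
  move=> h; apply: limit_with_rate => a b a0 b0.
  exact: paraconvex_slopes.
have L1 h : `|F (x + h) - F x - L h| <= K * phi `|h|.
  by have := LP h 1 ltr01; rewrite /q scale1r divr1 powR1 mulr1.
have LZp c h : 0 < c -> L (c *: h) = c * L h.
  move=> c0.
  apply: (@eq_powR_small _ _ (K * phi `|c *: h| + c * (K * phi `|h| * c `^ alpha))).
  move=> s s0.
  have qE : q (c *: h) s = c * q h (c * s).
    by rewrite /q scalerA (mulrC s); field; rewrite !gt_eqF.
  have := LP (c *: h) s s0.
  have cs0 : 0 < c * s by rewrite mulr_gt0.
  have := ler_wpM2l (ltW c0) (LP h _ cs0).
  rewrite qE powRM ?(ltW c0) ?(ltW s0) //.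
  rewrite -{1}(gtr0_norm c0) -normrM mulrBr => H1 H2.
  have := ler_normB (c * q h (c * s) - c * L h) (c * q h (c * s) - L (c *: h)).
  rewrite (_ : _ - _ - _ = L (c *: h) - c * L h); last by ring.
  move: H1 H2; lra.
have LD u w : L (u + w) = L u + L w.
  apply: (@eq_powR_small _ _ (K * phi `|u + w| + K * phi `|u - w| +
    K * phi `|u| * 2 `^ alpha + K * phi `|w| * 2 `^ alpha)) => s s0.
  have s20 : 0 < 2 * s by rewrite mulr_gt0.
  have := LP u _ s20; have := LP w _ s20; have := LP (u + w) _ s0.
  rewrite powRM ?(ltW s0) //.
  have qE : `|q u (2 * s) + q w (2 * s) - q (u + w) s| <=
      K * phi `|u - w| * s `^ alpha.
    have h0 : 0 <= 2^-1 :> R by [].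
    have h2 : 2^-1 + 2^-1 = 1 :> R by field.
    have E1 : x + s *: (u + w) + 2^-1 *: ((2 * s) *: (u - w)) = x + (2 * s) *: u.
      rewrite scalerA mulrA mulVf // mul1r -addrA -scalerDr addrACA subrr addr0.
      by rewrite -mulr2n -scaler_nat scalerA (mulrC s).
    have E2 : x + s *: (u + w) - 2^-1 *: ((2 * s) *: (u - w)) = x + (2 * s) *: w.
      rewrite scalerA mulrA mulVf // mul1r -addrA -scalerBr opprB [u + w]addrC.
      by rewrite addrACA subrr addr0 -mulr2n -scaler_nat scalerA (mulrC s).
    have := cF (x + s *: (u + w)) ((2 * s) *: (u - w)) _ _ h0 h0 h2.
    have := cNF (x + s *: (u + w)) ((2 * s) *: (u - w)) _ _ h0 h0 h2.
    rewrite E1 E2 -mulrDl h2 mul1r scalerA (mulrA 2^-1) mulVf // mul1r.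
    rewrite normrZ (gtr0_norm s0) phiM ?(ltW s0) // => H1 H2.
    have -> : q u (2 * s) + q w (2 * s) - q (u + w) s =
      s^-1 * (2^-1 * F (x + (2 * s) *: u) + 2^-1 * F (x + (2 * s) *: w)
        - F (x + s *: (u + w))).
      by rewrite /q; field; rewrite gt_eqF.
    rewrite normrM gtr0_norm ?invr_gt0 // ler_pdivrMl // ler_norml.
    by move: H1 H2; lra.
  move: qE; rewrite !ler_norml => /andP[? ?] /andP[? ?] /andP[? ?] /andP[? ?].
  by apply/andP; split; lra.
have L0 : L 0 = 0 by have := LD 0 0; rewrite addr0; lra.
have LN u : L (- u) = - L u.
  by have := LD u (- u); rewrite subrr L0; lra.
have LZ c u : L (c *: u) = c * L u.
  have [c0|c0|->] := ltgtP c 0; last by rewrite scale0r L0 mul0r.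
    have c0N : 0 < - c by rewrite oppr_gt0.
    by rewrite -{1}(opprK c) scaleNr LN LZp // mulNr opprK.
  exact: LZp.
have [v vP] : exists v, forall h, L h = ip v h.
  apply: (@riesz _ _ _ ip_norm L (2 * B + K * phi 1)) => // h.
  have [->|hN0] := eqVneq h 0; first by rewrite L0 !normr0 mulr0.
  have h0 : 0 < `|h| by rewrite normr_gt0.
  rewrite -ler_pdivrMr //.
  have u1 : `| `|h|^-1 *: h| = 1.
    by rewrite normrZ gtr0_norm ?invr_gt0 // mulVf // gt_eqF.
  have -> : `|L h| / `|h| = `|L (`|h|^-1 *: h)|.
    by rewrite LZ normrM (gtr0_norm (x := _^-1)) ?invr_gt0 // mulrC.
  have := L1 (`|h|^-1 *: h); have := FB (`|h|^-1 *: h).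
  have := FB 0; rewrite u1 normr0 addr0 => /(_ ler01) + /(_ (lexx _)).
  rewrite !ler_norml => /andP[? ?] /andP[? ?] /andP[? ?].
  by apply/andP; split; lra.
by exists v => h; rewrite -vP.
Qed.

(** Expanding [F] at [x] with increment [h], and at [y] with increments
    [x - y + h] and [x - y], bounds [<g x - g y, h>] by three remainders.  The
    increment [h] is taken of norm [|x - y|] in the direction of [g x - g y];
    then the remainders add up to at most [(1 + 4 + 1) K phi |x - y|]. *)
Lemma taylor_hoelder K F (g : X -> X) : 0 <= K ->
  (forall x h, `|F (x + h) - F x - ip (g x) h| <= K * phi `|h|) ->
  forall x y, `|g x - g y| <= 6 * K * `|x - y| `^ alpha.
Proof.
move=> K0 T x y.
have [<-|xy] := eqVneq x y; first by rewrite !subrr normr0 mulr_ge0 ?powR_ge0 // mulr_ge0.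
have [->|gxy] := eqVneq (g x) (g y).
  by rewrite subrr normr0 mulr_ge0 ?powR_ge0 // mulr_ge0.
pose v := g x - g y; pose r := `|x - y|.
have v0 : 0 < `|v| by rewrite normr_gt0 subr_eq0.
have r0 : 0 < r by rewrite normr_gt0 subr_eq0.
pose h := (r / `|v|) *: v.
have hr : `|h| = r.
  by rewrite /h normrZ gtr0_norm ?divr_gt0 // divfK // gt_eqF.
have ipvh : ip v h = r * `|v|.
  by rewrite /h ipZr ip_norm; field; rewrite gt_eqF.
have T1 := T x h; have T2 := T y (x - y + h); have T3 := T y (x - y).
have phi2 : phi `|x - y + h| <= 4 * phi r.
  apply: (@le_trans _ _ (phi (2 * r))).
    apply: ler_phi => //; apply: le_trans (ler_normD _ _) _.
    by rewrite hr -/r; lra.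
  rewrite phiM ?(ltW r0) // ler_wpM2r ?phi_ge0 //.
  have : 2 `^ alpha <= 2 `^ 1 :> R by rewrite ler_powR // ler1n.
  by rewrite powRr1 //; lra.
have key : r * `|v| <= 6 * K * phi r.
  rewrite -ipvh /v ipDl ipNl.
  have K2 := ler_wpM2l K0 phi2.
  move: T1 T2 T3; rewrite -/r hr (addrA y) subrKC (ipDr ip _ (x - y)).
  rewrite !ler_norml => /andP[? ?] /andP[? ?] /andP[? ?]; lra.
rewrite -/v -/r -(ler_pM2l r0); apply: le_trans key _.
rewrite [leRHS]mulrCA; apply: ler_wpM2l; first by rewrite mulr_ge0.
rewrite /Defs.phi powR1D ?(ltW r0) // ler_pdivrMr ?addr_gt0 //.
by rewrite ler_peMr ?mulr_ge0 ?powR_ge0 ?(ltW r0) // lerDl ltW.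
Qed.

Lemma is_derive_line F x h (s : R) : differentiable F (x + s *: h) ->
  is_derive s 1 (fun s => F (x + s *: h)) ('d F (x + s *: h) h).
Proof.
move=> dF; rewrite -deriveE //.
have E : (fun t : R => t^-1 *: (((fun s => F (x + s *: h)) \o shift s)
      (t *: (1 : R)) - F (x + s *: h)))
  = (fun t : R => t^-1 *: ((F \o shift (x + s *: h)) (t *: h) - F (x + s *: h))).
  apply/funext => t /=; congr (_ *: (F _ - _)).
  by rewrite -[t *: 1]/(t * 1) mulr1 scalerDl addrCA.
have D : derivable F (x + s *: h) h by exact: diff_derivable.
split; first by rewrite /derivable E.
by rewrite /derive E.
Qed.

Lemma hoelder_taylor F : C1alpha ip alpha F -> exists2 K, 0 <= K &
  forall x h, `|F (x + h) - F x - ip (grad ip F x) h| <= K * phi `|h|.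
Proof.
move=> [dF [C [C0 FC]]]; exists ((1 + alpha) * C).
  by rewrite mulr_ge0 ?(ltW C0) // addr_ge0 // ltW.
move=> x h.
have dl s := is_derive_line (dF (x + s *: h)).
have cl : {within `[0, 1], continuous (fun s : R => F (x + s *: h))}.
  by apply: derivable_within_continuous => s _; case: (dl s).
have [s s01 E] := MVT ltr01 (fun s _ => dl s) cl.
move: E; rewrite scale1r scale0r addr0 subr0 mulr1 => ->.
rewrite (diff_grad ip_norm) // -ipNl -ipDl.
apply: le_trans (cauchy_schwarz ip_norm _ _) _.
have -> : (1 + alpha) * C * phi `|h| = C * `|h| `^ alpha * `|h|.
  by rewrite /Defs.phi powR1D //; field; rewrite gt_eqF // addr_gt0.
rewrite ler_wpM2r //; apply: le_trans (FC _ _) _.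
rewrite ler_wpM2l ?(ltW C0) // ge0_ler_powR ?nnegrE ?(ltW alpha_gt0) //.
move: s01; rewrite in_itv /= => /andP[s0 s1].
by rewrite addrAC subrr add0r normrZ gtr0_norm // ler_piMl // ltW.
Qed.

End Taylor.

(** * The jet constant and the extension *)

Section JetConstant.
Context {R : realType} {X : completeNormedModType R} (ip : {dot X for idfun}).
Variable alpha : R.
Hypothesis alpha_gt0 : 0 < alpha.
Local Notation phi := (phi alpha).
Implicit Types (E : set X) (f : X -> R) (G : X -> X) (M : R).

Lemma phi_sum_gt0 (a b : R) : 0 <= a -> 0 <= b -> 0 < a + b ->
  0 < phi a + phi b.
Proof.
move=> a0 b0 ab0; have [aE|aN0] := eqVneq a 0.
  by rewrite ltr_wpDl ?phi_ge0 ?phi_gt0 //; move: ab0; rewrite aE add0r.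
by rewrite ltr_pwDl ?phi_ge0 ?phi_gt0 // lt_neqAle eq_sym aN0.
Qed.

Lemma jet_const_le E f G M : 0 <= M ->
  (forall x y z, E y -> E z ->
     `|f y + ip (G y) (x - y) - f z - ip (G z) (x - z)|
     <= M * (phi `|x - y| + phi `|x - z|)) ->
  (jet_const ip alpha E f G <= M%:E)%E.
Proof.
move=> M0 fM; apply: ge_ereal_sup => _ [-> | [x [y [z [Ey Ez xyz ->]]]]].
  by rewrite lee_fin.
by rewrite lee_fin ler_pdivrMr ?fM // phi_sum_gt0.
Qed.

(** The bound also covers [x = y = z], where the quotient is not taken: there the
    numerator vanishes. *)
Lemma jet_const_bound E f G : (jet_const ip alpha E f G < +oo)%E ->
  exists M, [/\ 0 <= M, jet_const ip alpha E f G = M%:E &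
    forall x y z, E y -> E z ->
     `|f y + ip (G y) (x - y) - f z - ip (G z) (x - z)|
     <= M * (phi `|x - y| + phi `|x - z|)].
Proof.
move=> Aoo.
have A0 : (0 <= jet_const ip alpha E f G)%E by apply: ereal_sup_ubound; left.
have AE : jet_const ip alpha E f G = (fine (jet_const ip alpha E f G))%:E.
  by rewrite fineK // ge0_fin_numE.
exists (fine (jet_const ip alpha E f G)); split => [||x y z Ey Ez] //.
  exact: fine_ge0.
have [xyz|] := ltP 0 (`|x - y| + `|x - z|); last first.
  move=> xyz.
  have [/eqP xy /eqP xz] : `|x - y| == 0 /\ `|x - z| == 0.
    by split; rewrite eq_le normr_ge0 andbT;
      have := normr_ge0 (x - y); have := normr_ge0 (x - z); lra.
  move: xy xz => /normr0_eq0/subr0_eq <- /normr0_eq0/subr0_eq <-.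
  rewrite !subrr !ip0r addr0 subr0 subrr !normr0.
  by apply: mulr_ge0; rewrite ?fine_ge0 // addr_ge0 // phi_ge0.
have d0 := phi_sum_gt0 (normr_ge0 (x - y)) (normr_ge0 (x - z)) xyz.
rewrite -ler_pdivrMr // -lee_fin -AE; apply: ereal_sup_ubound; right.
by exists x, y, z.
Qed.

Lemma taylor_jet_const_le E f G (F : X -> R) K : 0 <= K ->
  (forall x h, E x -> `|F (x + h) - f x - ip (G x) h| <= K * phi `|h|) ->
  (jet_const ip alpha E f G <= K%:E)%E.
Proof.
move=> K0 T; apply: jet_const_le => // x y z Ey Ez.
have := T y (x - y) Ey; have := T z (x - z) Ez.
by rewrite !subrKC !ler_norml => /andP[? ?] /andP[? ?]; apply/andP; split; lra.
Qed.

End JetConstant.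

(** The upper cones and the lower cone at one point of [E] are the data of
    [paraconvex_sandwich]; the other lower cones are competitors, so they lie below
    [F] too, which forces the jet of [F] on [E]. *)
Lemma hoelder_jet_extension (R : realType) (X : completeNormedModType R)
    (ip : {dot X for idfun}) (ip_norm : induces_norm ip)
    (alpha M : R) (alpha_gt0 : 0 < alpha) (alpha_le1 : alpha <= 1) (M0 : 0 <= M)
    (E : set X) (E_neq0 : E !=set0) (f : X -> R) (G : X -> X) :
  (forall x y z, E y -> E z ->
     `|f y + ip (G y) (x - y) - f z - ip (G z) (x - z)|
     <= M * (phi alpha `|x - y| + phi alpha `|x - z|)) ->
  exists F : X -> R, extends_jet ip E f G F /\
    forall x, differentiable F x /\ forall h,
      `|F (x + h) - F x - ip (grad ip F x) h|
      <= 2 `^ (1 - alpha) * M * phi alpha `|h|.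
Proof.
move=> fM; set K := 2 `^ (1 - alpha) * M.
have K0 : 0 <= K by rewrite mulr_ge0 ?powR_ge0.
pose up z x := f z + ip (G z) (x - z) + M * phi alpha `|x - z|.
pose lo y x := f y + ip (G y) (x - y) - M * phi alpha `|x - y|.
have lo_up x y z : E y -> E z -> lo y x <= up z x.
  move=> Ey Ez; have := fM x y z Ey Ez.
  by rewrite ler_norml /lo /up => /andP[_]; lra.
have lo_pc y : paraconvex alpha K (lo y) by exact: paraconvex_cone.
have up_pc z : paraconvex alpha K (fun x => - up z x).
  rewrite (_ : (fun x => - up z x) =
    (fun x => - f z + ip (- G z) (x - z) - M * phi alpha `|x - z|)).
    exact: paraconvex_cone.
  by apply/funext => x; rewrite /up ipNl; ring.
have [e Ee] := E_neq0.
have upU : up @` E !=set0 by exists (up e), e.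
have up_pcU u : (up @` E) u -> paraconvex alpha K (fun x => - u x) by case=> z _ <-.
have lo_upU u x : (up @` E) u -> lo e x <= u x by case=> z Ez <-; exact: lo_up.
have [F [cF cNF loF Fup]] := paraconvex_sandwich upU up_pcU (lo_pc e) lo_upU.
have {}loF y x : E y -> lo y x <= F x.
  by move=> Ey; apply: loF => // _ {}x [z Ez <-]; exact: lo_up.
have {}Fup z x : E z -> F x <= up z x by move=> Ez; apply: Fup; exists z.
have Fbnd x : exists B, forall h, `|h| <= 1 -> `|F (x + h)| <= B.
  have [B1 loB] := cone_bounded ip_norm alpha_gt0 (f e) (G e) e x M0.
  have [B2 upB] := cone_bounded ip_norm alpha_gt0 (- f e) (- G e) e x M0.
  exists (B1 + B2) => h h1.
  have := loB h h1; have := upB h h1; have := loF e (x + h) Ee.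
  have := Fup e (x + h) Ee; rewrite /lo /up ipNl.
  have := normr_ge0 (f e + ip (G e) (x + h - e) - M * phi alpha `|x + h - e|).
  rewrite !ler_norml => ? ? ? /andP[? ?] /andP[? ?]; apply/andP; split; lra.
have T x : differentiable F x /\ forall h,
    `|F (x + h) - F x - ip (grad ip F x) h| <= K * phi alpha `|h|.
  have [v vP] := paraconvex_taylor ip_norm alpha_gt0 K0 cF cNF (Fbnd x).
  by have [dF ->] := taylor_grad ip_norm alpha_gt0 vP.
exists F; split => // x Ex.
have Fx : F x = f x.
  apply/eqP; rewrite eq_le; have := loF x x Ex; have := Fup x x Ex.
  by rewrite /lo /up subrr ip0r normr0 phi0 // mulr0 !addr0 subr0 => -> ->.
split => //; apply: (proj2 (taylor_grad ip_norm alpha_gt0 (K := M) _)) => h.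
have := loF x (x + h) Ex; have := Fup x (x + h) Ex.
have xh : x + h - x = h by rewrite addrAC subrr add0r.
by rewrite /lo /up Fx xh ler_norml => ? ?; apply/andP; split; lra.
Qed.

Theorem theorem1p7 (R : realType) (X : completeNormedModType R)
    (ip : {dot X for idfun}) (ip_norm : induces_norm ip)
    (alpha : R) (alpha_gt0 : 0 < alpha) (alpha_le1 : alpha <= 1)
    (E : set X) (E_neq0 : E !=set0) (f : X -> R) (G : X -> X) :
  ((exists F : X -> R, C1alpha ip alpha F /\ extends_jet ip E f G F) <->
   (jet_const ip alpha E f G < +oo)%E) /\
  ((jet_const ip alpha E f G < +oo)%E ->
   exists F : X -> R,
     [/\ C1alpha ip alpha F, extends_jet ip E f G F &
         (jet_const ip alpha [set: X] F (grad ip F) <=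
          (2 `^ (1 - alpha))%:E * jet_const ip alpha E f G)%E]).
Proof.
have sufficiency : (jet_const ip alpha E f G < +oo)%E -> exists F : X -> R,
    [/\ C1alpha ip alpha F, extends_jet ip E f G F &
        (jet_const ip alpha [set: X] F (grad ip F) <=
         (2 `^ (1 - alpha))%:E * jet_const ip alpha E f G)%E].
  move=> /(jet_const_bound alpha_gt0)[M [M0 -> fM]].
  have [F [Fext T]] :=
    hoelder_jet_extension ip_norm alpha_gt0 alpha_le1 M0 E_neq0 fM.
  have K0 : 0 <= 2 `^ (1 - alpha) * M by rewrite mulr_ge0 ?powR_ge0.
  exists F; split => //.
    split => [x|]; first by case: (T x).
    exists (6 * (2 `^ (1 - alpha) * M) + 1).
    split=> [|x y]; first by rewrite ltr_wpDl // mulr_ge0.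
    apply: le_trans (taylor_hoelder ip_norm alpha_gt0 alpha_le1 K0 _ x y) _.
      by move=> z; case: (T z).
    by rewrite ler_wpM2r ?powR_ge0 // lerDl.
  rewrite -EFinM; apply: (@taylor_jet_const_le _ _ _ _ alpha_gt0 _ _ _ F) => // x h _.
  by case: (T x).
split=> //; split=> [[F [FC Fext]]|/sufficiency[F [FC Fext _]]]; last by exists F.
have [K K0 T] := hoelder_taylor ip_norm alpha_gt0 FC.
apply: le_lt_trans (ltry K).
apply: (@taylor_jet_const_le _ _ _ _ alpha_gt0 _ _ _ F) => // x h Ex.
by have [<- <-] := Fext x Ex.
Qed.
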